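(* Let $A$ be a finite alphabet and let $\{F_a:a\in A\}$ be a Möbius iterative system having a nontrivial inward set, i.e. a nonempty closed set $W\subseteq\mathbb{T}$, $W\neq\mathbb{T}$, with $\bigcup_{a\in A}F_a(W)\subseteq\mathrm{Int}(W)$. Then there is no Möbius number system for $\{F_a:a\in A\}$.
   Context: $\mathbb{T}$ is the unit circle in $\mathbb{C}$; $\mathrm{Int}$ denotes interior in $\mathbb{T}$. A disc preserving Möbius transformation is a map $F(z)=\frac{\alpha z+\beta}{\overline\beta z+\overline\alpha}$ with $|\alpha|^2-|\beta|^2=1$. $A^\omega$ is the set of one-sided infinite words over $A$ with the product topology; $w_{[0,n)}=w_0\cdots w_{n-1}$. A subshift is a closed set $\Sigma\subseteq A^\omega$ with $\sigma(\Sigma)\subseteq\Sigma$, where $\sigma(w)_i=w_{i+1}$. A Möbius iterative system is a family $\{F_a:a\in A\}$ of disc preserving Möbius transformations. For $v=v_0\cdots v_{n-1}$ put $F_v=F_{v_0}\circ\cdots\circ F_{v_{n-1}}$. A sequence $\{G_n\}$ of disc preserving Möbius transformations represents $x\in\mathbb{T}$ if $G_n\mu\to\delta_x$ weakly$^*$, where $\mu$ is the uniform probability measure on $\mathbb{T}$ and $G\mu(E)=\mu(G^{-1}(E))$. For $w\in A^\omega$, $\Phi(w)$ is the point $x\in\mathbb{T}$ represented by $\{F_{w_{[0,n)}}\}_{n=1}^\infty$ if it exists, and is undefined otherwise. A subshift $\Sigma\subseteq A^\omega$ is a Möbius number system for $\{F_a\}$ if $\Phi$ is defined on all of $\Sigma$,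 $\Phi(\Sigma)=\mathbb{T}$ and $\Phi|_{\Sigma}$ is continuous. *)

(* Defs.v *)
From HB Require Import structures.
From mathcomp Require Import all_boot all_order all_algebra.
From mathcomp Require Import all_classical all_reals all_analysis.
From mathcomp Require Import complex.

Set Implicit Arguments.
Unset Strict Implicit.
Unset Printing Implicit Defensive.

Import Order.TTheory GRing.Theory Num.Theory.
Import numFieldNormedType.Exports.

Local Open Scope classical_set_scope.
Local Open Scope ring_scope.

(* The analysis library attaches the norm topology to the carrier of a
   numFieldType structure; packing R[i] as such a structure makes it available. *)
Definition Cplx (R : realType) : numClosedFieldType := R[i].

(* As a [set_type], the circle carries the topology induced from the complex
   plane, so that interiors and closed sets below are relative to the circle. *)
Definition circle (R : realType) : Type :=
  set_type [set z : Cplx R | `|z| = 1].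

HB.instance Definition _ (R : realType) := Topological.on (circle R).

Lemma circle1_subproof (R : realType) :
  (1 : Cplx R) \in [set z : Cplx R | `|z| = 1].
Proof. by rewrite inE /= normr1. Qed.

Definition circle1 (R : realType) : circle R :=
  SigSub (circle1_subproof R).

HB.instance Definition _ (R : realType) :=
  isPointed.Build (circle R) (circle1 R).

HB.instance Definition _ (R : realType) :=
  Measurable.copy (circle R) (g_sigma_algebraType (@open (circle R))).

Lemma circle_exp_subproof (R : realType) (t : R) :
  (cos (2 * pi * t) +i* sin (2 * pi * t) : Cplx R)%C
    \in [set z : Cplx R | `|z| = 1].
Proof. by rewrite inE /= normc_def /= cos2Dsin2 sqrtr1. Qed.

Definition circle_exp (R : realType) (t : R) : circle R :=
  SigSub (circle_exp_subproof t).

(* The uniform probability measure of the circle, as the image of the uniform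
   probability on [0, 1] under t |-> exp(2 i pi t). *)
Definition circle_unif (R : realType) : set (circle R) -> \bar R :=
  pushforward (uniform_prob (@ltr01 R)) (@circle_exp R).

Definition weak_star_cvg (R : realType)
    (nu : nat -> set (circle R) -> \bar R) (nu0 : set (circle R) -> \bar R) :=
  forall f : circle R -> R, continuous f ->
    (\int[nu n]_x (f x)%:E)%E @[n --> \oo] --> (\int[nu0]_x (f x)%:E)%E.

Definition moebius_map (R : realType) (alpha beta z : Cplx R) : Cplx R :=
  (alpha * z + beta) / (beta^* * z + alpha^*).

(* Disc preserving Moebius transformations are handled through their action on
   the circle, which determines them. *)
Definition disc_preserving_moebius (R : realType) (F : circle R -> circle R) :=
  exists alpha beta : Cplx R,
    `|alpha| ^+ 2 - `|beta| ^+ 2 = 1 /\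
    forall z : circle R, set_val (F z) = moebius_map alpha beta (set_val z).

Definition moebius_iterative_system (R : realType) (A : finType)
    (F : A -> circle R -> circle R) :=
  forall a, disc_preserving_moebius (F a).

Definition word_map (R : realType) (A : finType) (F : A -> circle R -> circle R)
    (v : seq A) : circle R -> circle R :=
  foldr (fun a G => F a \o G) id v.

Definition represents (R : realType) (G : nat -> circle R -> circle R)
    (x : circle R) :=
  weak_star_cvg (fun n => pushforward (@circle_unif R) (G n)) \d_x.

(* One-sided infinite words, with the product of the discrete topologies. *)
Definition words (A : finType) : topologicalType :=
  {ptws nat -> discrete_topology A}.

Definition shift (A : finType) (w : words A) : words A := fun i => w i.+1.

(* [mkseq w n] is the prefix w_0 ... w_(n-1); the sequence starts at n = 1. *)
Definition prefix_maps (R : realType) (A : finType)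
    (F : A -> circle R -> circle R) (w : words A) : nat -> circle R -> circle R :=
  fun n => word_map F (mkseq w n.+1).

Definition Phi_dom (R : realType) (A : finType) (F : A -> circle R -> circle R)
    : set (words A) :=
  [set w | exists x, represents (prefix_maps F w) x].

(* The represented point on [Phi_dom F], a default value elsewhere. *)
Definition Phi (R : realType) (A : finType) (F : A -> circle R -> circle R)
    (w : words A) : circle R :=
  get (represents (prefix_maps F w)).

Definition subshift (A : finType) (Sigma : set (words A)) :=
  closed Sigma /\ @shift A @` Sigma `<=` Sigma.

Definition moebius_number_system (R : realType) (A : finType)
    (F : A -> circle R -> circle R) (Sigma : set (words A)) :=
  [/\ subshift Sigma,
      Sigma `<=` Phi_dom F,
      Phi F @` Sigma = [set: circle R] &
      {within Sigma, continuous (Phi F)}].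

Definition nontrivial_inward_set (R : realType) (A : finType)
    (F : A -> circle R -> circle R) (W : set (circle R)) :=
  [/\ W !=set0, closed W, W <> [set: circle R] &
      \bigcup_a (F a @` W) `<=` W°].

(* Main.v *)
Require Import Defs.
From mathcomp Require Import all_boot all_order all_algebra.
From mathcomp Require Import all_classical all_reals all_analysis.
From mathcomp Require Import measurable_realfun complex lra.

(** An inward set traps every represented point. Since each [F a] maps the
    closed set [W] into itself, so does every prefix map [G n] of a word, hence
    [G n] pulls [W] back to a set containing [W]: the image of the uniform
    measure under [G n] gives [W] at least the mass that the uniform measure
    gives it. That mass is bounded below by the uniform measure of the interior
    of [W], which is positive because the interior is open and nonempty (it
    contains the image of [W] under any [F a]). If the images converge weakly
    to a Dirac mass at [x], then testing against a continuous function that is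
    [0] at [x] and [1] on [W] shows that [x] cannot lie outside [W]
    ([represented_in_inward]). So the points represented by infinite words all
    belong to [W]; as [W] is not the whole circle, no subshift represents every
    point of the circle.

    Two analytic facts support this: Moebius transformations act continuously
    on the circle, so that integrals against the image measures make sense
    ([disc_preserving_moebius_continuous]), and the uniform measure charges
    every nonempty open set ([circle_unif_gt0]). *)

Set Implicit Arguments.
Unset Strict Implicit.
Unset Printing Implicit Defensive.

Import Order.TTheory GRing.Theory Num.Theory.
Import numFieldNormedType.Exports.

Local Open Scope classical_set_scope.
Local Open Scope ring_scope.

(** * Topology and Borel sets of the circle *)

Lemma set_val_circle_inj (R : realType) :
  injective (set_val : circle R -> Cplx R).
Proof.
move=> x y.
exact: (@val_inj _ _ {z : Cplx R | z \in [set z : Cplx R | `|z| = 1]}).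
Qed.

Lemma set_val_circle_continuous (R : realType) :
  continuous (set_val : circle R -> Cplx R).
Proof. exact: initial_continuous. Qed.

(** The topology of the circle is the initial one for the inclusion in the
    plane, so continuity of circle-valued maps can be checked in the plane. *)
Lemma continuous_into_circle (R : realType) (T : topologicalType)
    (f : T -> circle R) :
  continuous (fun z => set_val (f z) : Cplx R) -> continuous f.
Proof.
exact: (@continuous_comp_initial _ _ _ (set_val : circle R -> Cplx R)).
Qed.

(** The circle is completely regular, because its topology comes from the
    uniform structure induced by the plane. *)
Lemma circle_urysohn (R : realType) (x : circle R) (W : set (circle R)) :
  closed W -> ~ W x ->
  exists f : circle R -> R,
    [/\ continuous f, forall z, 0 <= f z, f x = 0 &
        forall z, W z -> f z = 1].
Proof.
move=> cW Wx.
have [f [cf f01 fx fW]] : exists f : circle R -> R,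
    [/\ continuous f, range f `<=` `[0, 1],
        f @` [set x] `<=` [set 0] & f @` W `<=` [set 1]].
  apply/uniform_separatorP.
  exact: (@uniform_completely_regular R
    (set_type [set z : Cplx R | `|z| = 1]) x W cW Wx).
exists f; split => [//|z||z Wz].
- by have /f01 : range f (f z) by []; rewrite /= in_itv /= => /andP[].
- by apply: fx; exists x.
- by apply: fW; exists z.
Qed.

Lemma closed_circle_measurable (R : realType) (W : set (circle R)) :
  closed W -> measurable W.
Proof.
move=> cW; rewrite -[W]setCK; apply: measurableC; apply: sub_sigma_algebra.
exact: closed_openC.
Qed.

Lemma continuous_circle_measurable_fun (R : realType) (f : circle R -> R) :
  continuous f -> measurable_fun setT f.
Proof.
move=> cf; apply: (measurability _ (RGenOInfty.measurableE R)) => //.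
move=> _ [_ [a ->] <-]; rewrite setTI; apply: sub_sigma_algebra.
exact: open_comp.
Qed.

Lemma continuous_curve_measurable_fun (R : realType) (f : R -> circle R) :
  continuous f -> measurable_fun setT f.
Proof.
move=> cf; apply: (@measurability _ _ _ _ _ _ (@open (circle R))) => //.
move=> _ [U oU <-]; rewrite setTI; apply: open_measurable.
exact: open_comp.
Qed.

(** * Continuity of Moebius transformations *)

(** Stated over an abstract field and along an abstract filter: with the
    concrete complex numbers, unification unfolds the neighbourhood filters. *)
Lemma cvg_homography (K : numFieldType) T (G : set_system T) (FG : Filter G)
    (f : T -> K) (a b c d u : K) :
  c * u + d != 0 -> f x @[x --> G] --> u ->
  (a * f x + b) / (c * f x + d) @[x --> G] --> (a * u + b) / (c * u + d).
Proof.
move=> nz fu.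
have affine_cvg (p q : K) : p * f x + q @[x --> G] --> p * u + q.
  by apply: cvgD; [apply: cvgM => //; exact: cvg_cst|exact: cvg_cst].
by apply: cvgM; [exact: affine_cvg|apply: cvgV => //; exact: affine_cvg].
Qed.

(** The pole of the transformation is off the circle: on the circle the
    denominator [beta^* z + alpha^*] could only vanish if
    [`|alpha| = `|beta|]. *)
Lemma disc_preserving_moebius_continuous (R : realType)
    (F : circle R -> circle R) :
  disc_preserving_moebius F -> continuous F.
Proof.
move=> [al [be [hab hF]]]; apply: continuous_into_circle.
rewrite (_ : (fun z => _) = (fun z => moebius_map al be (set_val z)));
  last exact/funext.
move=> z; rewrite /moebius_map.
have nz : be^* * set_val z + al^* != 0.
  apply/eqP => /eqP; rewrite addr_eq0 => /eqP /(congr1 Num.norm).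
  have -> : `|be^* * set_val z| = `|be|.
    by have /= hz := set_valP z; rewrite normrM hz mulr1 norm_conjC.
  rewrite normrN norm_conjC => h.
  by move/eqP: hab; rewrite h subrr eq_sym oner_eq0.
exact: (@cvg_homography (Cplx R) _ (nbhs z) (nbhs_filter z) set_val
  _ _ _ _ _ nz (@set_val_circle_continuous R z)).
Qed.

Lemma word_map_continuous (R : realType) (A : finType)
    (F : A -> circle R -> circle R) (v : seq A) :
  (forall a, continuous (F a)) -> continuous (word_map F v).
Proof.
move=> cF; elim: v => [|a v IH] z; first exact: cvg_id.
exact: (continuous_comp (IH z) (cF a _)).
Qed.

Lemma word_map_invariant (R : realType) (A : finType)
    (F : A -> circle R -> circle R) (W : set (circle R)) (v : seq A) :
  (forall a, F a @` W `<=` W) -> word_map F v @` W `<=` W.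
Proof.
move=> FW; elim: v => [|a v IH] _ [z Wz <-] //=.
by apply: FW; exists (word_map F v z) => //; apply: IH; exists z.
Qed.

(** * The uniform measure charges open sets *)

Lemma real_complex_continuous (R : realType) :
  continuous (fun x : R => real_complex R x : Cplx R).
Proof.
move=> x; apply/cvgrPdist_lt => e e0.
have eR : e = real_complex R (complex.Re e).
  by move: e0; case: e => a b; rewrite ltcE /= => /andP[/eqP -> _].
have re0 : 0 < complex.Re e by move: e0; rewrite eR ltcR.
apply: (@filterS _ (nbhs x) (nbhs_filter x) (ball x (complex.Re e)));
  last exact: nbhsx_ballx.
move=> y; rewrite /ball /= eR -rmorphB normc_def /= expr0n addr0 sqrtr_sqr.
by rewrite ltcR.
Qed.

Lemma cvg_add_scaled (K : numFieldType) T (G : set_system T) (FG : Filter G)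
    (f g : T -> K) (a b c : K) :
  f x @[x --> G] --> a -> g x @[x --> G] --> b ->
  f x + c * g x @[x --> G] --> a + c * b.
Proof.
by move=> fa gb; apply: cvgD => //; apply: cvgM => //; exact: cvg_cst.
Qed.

Lemma circle_expE (R : realType) (t : R) :
  set_val (circle_exp t) =
    (cos (2 * pi * t) +i* sin (2 * pi * t))%C :> Cplx R.
Proof. by []. Qed.

Lemma circle_exp_continuous (R : realType) : continuous (@circle_exp R).
Proof.
apply: continuous_into_circle => t.
rewrite (_ : (fun z => _) = (fun z =>
    real_complex R (cos (2 * pi * z)) +
    'i%C * real_complex R (sin (2 * pi * z)) : Cplx R)); last first.
  by apply/funext => z; rewrite /circle_exp /= [LHS]complexE.
have c : {for t, continuous (fun x : R => 2 * pi * x)}.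
  by apply: cvgMr; exact: cvg_id.
apply: (@cvg_add_scaled (Cplx R) _ (nbhs t) (nbhs_filter t)).
  exact: (continuous_comp (continuous_comp c (@continuous_cos _ _))
    (@real_complex_continuous R _)).
exact: (continuous_comp (continuous_comp c (@continuous_sin _ _))
  (@real_complex_continuous R _)).
Qed.

Lemma circle_exp_surj (R : realType) (z : circle R) :
  exists2 t : R, t \in `[0, 1] & circle_exp t = z.
Proof.
case E : (set_val z) => [a b].
have : `|set_val z : Cplx R| = 1 by exact: (set_valP z).
rewrite E normc_def /= => /complexI hz.
have h : a ^+ 2 + b ^+ 2 = 1.
  have ge0 : 0 <= a ^+ 2 + b ^+ 2 by rewrite addr_ge0 ?sqr_ge0.
  by rewrite -(sqr_sqrtr ge0) hz expr1n.
have a1 : -1 <= a <= 1.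
  by rewrite -ler_norml -(@expr_le1 _ 2)// real_normK ?num_real// -h lerDl
    sqr_ge0.
have pi0 : 0 < 2 * pi :> R by rewrite mulr_gt0 // pi_gt0.
pose th := acos a.
have th0 : 0 <= th := acos_ge0 a1.
have th1 : th / (2 * pi) <= 1.
  rewrite ler_pdivrMr // mul1r (le_trans (acos_lepi a1))//.
  by rewrite ler_peMl ?pi_ge0 // ler1n.
have c : cos th = a by rewrite acosK // in_itv.
have s : sin th = `|b| by rewrite sin_acos // -h addrAC subrr add0r sqrtr_sqr.
have thK : 2 * pi * (th / (2 * pi)) = th by rewrite mulrC divfK ?gt_eqF.
(* [acos] only reaches the upper half circle; the lower one is its mirror. *)
case: (leP 0 b) => hb.
  exists (th / (2 * pi)).
    by rewrite in_itv /= divr_ge0 ?(ltW pi0).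
  apply: set_val_circle_inj; rewrite [RHS]E circle_expE.
  by rewrite thK c s ger0_norm.
exists (1 - th / (2 * pi)).
  by rewrite in_itv /= subr_ge0 lerBlDr lerDl divr_ge0 ?(ltW pi0) // andbT.
apply: set_val_circle_inj; rewrite [RHS]E circle_expE.
rewrite mulrBr mulr1 thK.
by rewrite addrC mulr_natl cosD2pi sinD2pi cosN sinN c s (ltr0_norm hb) opprK.
Qed.

(** The interval is taken on the side of [t] that faces the midpoint of
    [[0, 1]], which keeps it inside even when [t] is an endpoint. *)
Lemma open_meets_unit_itv (R : realType) (V : set R) (t : R) :
  open V -> V t -> t \in `[0, 1] ->
  exists a b : R,
    [/\ a < b, `[a, b]%classic `<=` V &
        `[a, b]%classic `<=` `[0, 1]%classic].
Proof.
move=> oV Vt; rewrite in_itv /= => /andP[t0 t1].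
have /nbhs_ballP [e /= e0 be] : nbhs t V by exact: open_nbhs_nbhs.
pose d := Num.min (e / 2) (1 / 2).
have d0 : 0 < d by rewrite lt_min !divr_gt0.
have de : d < e by rewrite gt_min ltr_pdivrMr// ltr_pMr// ltr1n.
have d2 : d <= 1 / 2 by rewrite ge_min lexx orbT.
have [th|th] := leP t (1 / 2).
  exists t, (t + d); split; first by rewrite ltrDl.
    move=> x; rewrite /= in_itv /= => /andP[tx xd]; apply: be => /=.
    by rewrite /ball /= ltr_norml; apply/andP; split; lra.
  by move=> x; rewrite /= !in_itv /= => /andP[tx xd]; apply/andP; split; lra.
exists (t - d), t; split; first by rewrite ltrBlDr ltrDl.
  move=> x; rewrite /= in_itv /= => /andP[tx xd]; apply: be => /=.
  by rewrite /ball /= ltr_norml; apply/andP; split; lra.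
by move=> x; rewrite /= !in_itv /= => /andP[tx xd]; apply/andP; split; lra.
Qed.

(** The parametrization [circle_exp] is continuous and onto, so the preimage of
    a nonempty open set contains a nondegenerate interval of [[0, 1]]. *)
Lemma circle_unif_gt0 (R : realType) (U : set (circle R)) (z : circle R) :
  open U -> U z -> (0 < @circle_unif R U)%E.
Proof.
move=> oU Uz; have [t t01 tz] := circle_exp_surj z.
have oV : open (@circle_exp R @^-1` U).
  by apply: open_comp => // ? _; exact: circle_exp_continuous.
have Vt : (@circle_exp R @^-1` U) t by rewrite /= tz.
have [a [b [ab abV ab01]]] := open_meets_unit_itv oV Vt t01.
apply: (@lt_le_trans _ _ (uniform_prob (@ltr01 R) `[a, b]%classic));
  last first.
  by apply: le_measure => //; rewrite inE //; exact: open_measurable.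
rewrite /uniform_prob (eq_integral (cst 1%E)); last first.
  move=> x /[!inE] /ab01; rewrite /= in_itv /= /uniform_pdf => ->.
  by rewrite subr0 invr1.
rewrite integral_cst //= mul1e lebesgue_measure_itv /= lte_fin ab.
by rewrite lte_fin subr_gt0.
Qed.

(** * Represented points and inward sets *)

(** Markov's bound for a test function equal to [1] on [W]. *)
Lemma pushforward_le_integral (R : realType) d (T : measurableType d)
    (nu : {measure set T -> \bar R}) (G : T -> circle R) (W : set (circle R))
    (f : circle R -> R) :
  measurable_fun setT G -> closed W -> continuous f ->
  (forall z, 0 <= f z) -> (forall z, W z -> f z = 1) ->
  (nu (G @^-1` W) <= \int[pushforward nu G]_z (f z)%:E)%E.
Proof.
move=> mG cW cf f0 f1.
have mGW : measurable (G @^-1` W).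
  by rewrite -[_ @^-1` _]setTI; apply: mG => //; exact: closed_circle_measurable.
have mf : measurable_fun setT (EFin \o f).
  by apply/measurable_EFinP; exact: continuous_circle_measurable_fun.
rewrite (ge0_integral_pushforward mG nu measurableT mf) => [|z _];
  last by rewrite /= lee_fin.
rewrite preimage_setT -[leLHS]mul1e -integral_cst //.
rewrite (eq_integral (EFin \o f \o G)) => [|z /[!inE] /f1 /= -> //].
apply: ge0_subset_integral => //; first exact: measurableT_comp.
by move=> z _; rewrite /= lee_fin.
Qed.

(** The mass that the image measures give to [W] never drops below the uniform
    measure of its interior, whereas a limit Dirac mass outside [W] would force
    it to vanish. *)
Lemma represented_in_inward (R : realType) (G : nat -> circle R -> circle R)
    (x : circle R) (W : set (circle R)) :
  (forall n, continuous (G n)) -> (forall n, G n @` W `<=` W) ->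
  closed W -> W° !=set0 -> represents G x -> W x.
Proof.
move=> cG GW cW [z Wz] Gx; apply: contrapT => Wx.
have [f [cf f0 fx fW]] := circle_urysohn cW Wx.
pose c := uniform_prob (@ltr01 R) (@circle_exp R @^-1` W°).
have c0 : (0 < c)%E by apply: circle_unif_gt0 Wz; exact: open_interior.
have le_c n :
    (c <= \int[pushforward (@circle_unif R) (G n)]_z (f z)%:E)%E.
  have mGe : measurable_fun setT (G n \o @circle_exp R).
    apply: continuous_curve_measurable_fun => t.
    by apply: continuous_comp (cG n _); exact: circle_exp_continuous.
  (* Both push-forwards merge into one along [G n \o circle_exp]. *)
  apply: le_trans (@pushforward_le_integral _ _ _ (uniform_prob (@ltr01 R))
    _ W f mGe cW cf f0 fW).
  apply: le_measure; rewrite ?inE.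
  - apply: open_measurable; apply: open_comp; last exact: open_interior.
    by move=> ? _; exact: circle_exp_continuous.
  - rewrite -[_ @^-1` _]setTI; apply: mGe => //.
    exact: closed_circle_measurable.
  - by move=> t /interior_subset Wt; apply: GW; exists (circle_exp t).
have := Gx f cf.
rewrite integral_dirac //; last first.
  by apply/measurable_EFinP; exact: continuous_circle_measurable_fun.
rewrite fx mule0 => lim0.
have : (c <= 0)%E by apply: cvge_ge lim0; exact: nearW.
by rewrite leNgt c0.
Qed.

Theorem theorem35 (R : realType) (A : finType) (F : A -> circle R -> circle R)
    (hF : moebius_iterative_system F)
    (hW : exists W : set (circle R), nontrivial_inward_set F W) :
  ~ exists Sigma : set (words A), moebius_number_system F Sigma.
Proof.
move=> [Sigma [_ Sdom Sonto _]].
have [W [[z Wz] cW WT FW]] := hW.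
have cF a : continuous (F a) := disc_preserving_moebius_continuous (hF a).
suff : W = [set: circle R] by [].
rewrite -subTset => x _.
have : [set: circle R] x by [].
rewrite -Sonto => -[w Sw <-].
have rep : represents (prefix_maps F w) (Phi F w) := getPex (Sdom w Sw).
apply: (represented_in_inward _ _ cW _ rep) => [n|n|].
- exact: word_map_continuous.
- apply: word_map_invariant => a y Wy.
  by apply: interior_subset; apply: FW; exists a.
(* The letter [w 0] witnesses that the alphabet is nonempty. *)
- by exists (F (w 0%N) z); apply: FW; exists (w 0%N) => //; exists z.
Qed.
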